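(* Let $\Omega=(-1,1)$ and let $\mathbf{D}=-W'$ with $W:\mathbb{R}\to[0,\infty)$ smooth, strictly convex, even, with a unique global minimum at $0$. Let $g=g(t,\omega,m)\ge0$ be a (sufficiently regular) solution, symmetric in $(\omega,m)$, of $$\partial_t g(\omega,m)+\partial_\omega\big(a[g](\omega)g(\omega,m)\big)+\partial_m\big(a[g](m)g(\omega,m)\big)=0,\qquad(\omega,m)\in\Omega^2,$$ with zero-flux boundary conditions $a[g](\omega)g(\omega,m)=0$ for $\omega\in\partial\Omega$, $m\in\Omega$ (and symmetrically $a[g](m)g(\omega,m)=0$ for $m\in\partial\Omega$, $\omega\in\Omega$). Define $$\tilde V(t)=\int_\Omega\int_\Omega W(\omega-m)\,g(t,\omega,m)\,d\omega\,dm,\qquad h(t,\omega)=\int_\Omega g(t,\omega,m)\,dm.$$ Then $$\frac{d}{dt}\tilde V(t)\le-2\int_\Omega h(t,\omega)\,\big(a[g](\omega)\big)^2\,d\omega\le0.$$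
   Context: For a nonnegative function $g=g(\omega,m)$ on $\Omega^2$, $$a[g](\omega)=\int_\Omega\eta[g](\omega,m)\,\mathbf{D}(\omega-m)\,dm,\qquad \eta[g](\omega,m)=\frac{g(\omega,m)}{\int_\Omega g(\omega,m')\,dm'},$$ with $\eta[g](\omega,\cdot)=0$ if $g(\omega,\cdot)=0$ a.e. In the equation and the conclusion, $a[g]$ is computed from $g(t,\cdot,\cdot)$ at each time $t$, and the time argument is omitted. ''Sufficiently regular'' means that $g$ is $C^1$ on $[0,\infty)\times\overline\Omega^2$, that the flux $(t,\omega,m)\mapsto a[g](\omega)g(\omega,m)$ is continuous on $[0,\infty)\times\overline\Omega^2$ and $C^1$ in $\omega$ there, and that the equation holds pointwise, so that differentiation under the integral and integration by parts are justified. $g$ represents the distribution of edges between opinions. *)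

(* Defs.v *)
From HB Require Import structures.
From mathcomp Require Import all_boot all_order all_algebra.
From mathcomp Require Import all_classical all_reals all_analysis.

Set Implicit Arguments.
Unset Strict Implicit.
Unset Printing Implicit Defensive.

Import Order.TTheory GRing.Theory Num.Theory.
Import numFieldNormedType.Exports.

Local Open Scope classical_set_scope.
Local Open Scope ring_scope.

Section Calculus.
Variable R : realType.
Implicit Types (A : set R) (f : R -> R) (x : R).

(* Derivative relative to a set: one-sided at an endpoint of an interval A,
   and the usual derivative at an interior point of A. *)
Definition derivable_in A f x : Prop :=
  cvg ((fun y => (f y - f x) / (y - x)) @ within A x^').

Definition derive_in A f x : R :=
  lim ((fun y => (f y - f x) / (y - x)) @ within A x^').

Definition smooth f : Prop := forall (n : nat) (x : R), derivable (f^`(n))%classic x 1.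

Definition strictly_convex f : Prop :=
  forall x y s : R, x != y -> 0 < s < 1 ->
    f (s * x + (1 - s) * y) < s * f x + (1 - s) * f y.

End Calculus.

Section SpaceTime.
Variable R : realType.
Implicit Type f : R -> R -> R -> R.

Definition Omega : set R := `]-1, 1[.
Definition clOmega : set R := `[-1, 1].
Definition bdOmega : set R := [set -1; 1].
Definition times : set R := `[0, +oo[.

Definition cylinder : set (R * R * R) := times `*` clOmega `*` clOmega.

Definition cylinder_continuous f : Prop :=
  {within cylinder, continuous (fun p : R * R * R => f p.1.1 p.1.2 p.2)}.

Definition d_t f : R -> R -> R -> R :=
  fun t w m => derive_in times (fun s => f s w m) t.

Definition d_w f : R -> R -> R -> R :=
  fun t w m => derive_in clOmega (fun v => f t v m) w.

Definition d_m f : R -> R -> R -> R :=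
  fun t w m => derive_in clOmega (fun n => f t w n) m.

Definition C1_in_t f : Prop :=
  (forall t w m, times t -> clOmega w -> clOmega m ->
     derivable_in times (fun s => f s w m) t) /\
  cylinder_continuous (d_t f).

Definition C1_in_w f : Prop :=
  (forall t w m, times t -> clOmega w -> clOmega m ->
     derivable_in clOmega (fun v => f t v m) w) /\
  cylinder_continuous (d_w f).

Definition C1_in_m f : Prop :=
  (forall t w m, times t -> clOmega w -> clOmega m ->
     derivable_in clOmega (fun n => f t w n) m) /\
  cylinder_continuous (d_m f).

Definition C1 f : Prop :=
  [/\ cylinder_continuous f, C1_in_t f, C1_in_w f & C1_in_m f].

End SpaceTime.

Arguments Omega {R}.
Arguments clOmega {R}.
Arguments bdOmega {R}.
Arguments times {R}.

Section Model.
Variable R : realType.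
Local Notation mu := (@lebesgue_measure R).

Definition eta (g : R -> R -> R) (w m : R) : R :=
  if `[< {ae mu, forall m', Omega m' -> g w m' = 0} >] then 0
  else g w m / \int[mu]_(m' in Omega) g w m'.

Definition velocity (D : R -> R) (g : R -> R -> R) (w : R) : R :=
  \int[mu]_(m in Omega) (eta g w m * D (w - m)).

Definition flux_w (D : R -> R) (g : R -> R -> R -> R) (t w m : R) : R :=
  velocity D (g t) w * g t w m.

Definition flux_m (D : R -> R) (g : R -> R -> R -> R) (t w m : R) : R :=
  velocity D (g t) m * g t w m.

(* The regularity of flux_m on the cylinder is that of flux_w with w and m
   exchanged, since solutions are symmetric. *)
Definition sufficiently_regular (D : R -> R) (g : R -> R -> R -> R) : Prop :=
  [/\ C1 g, cylinder_continuous (flux_w D g) & C1_in_w (flux_w D g)].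

Definition Vtilde (W : R -> R) (g : R -> R -> R -> R) (t : R) : R :=
  \int[mu]_(m in Omega) \int[mu]_(w in Omega) (W (w - m) * g t w m).

Definition h (g : R -> R -> R -> R) (t w : R) : R :=
  \int[mu]_(m in Omega) g t w m.

End Model.

(* Main.v *)
(** Multiplying the equation by W(w - m) and integrating gives V' as minus the
sum of two terms, one per flux; by the symmetry of g and the evenness of W they
are equal. Integrating by parts in w, where the zero flux kills the boundary
term, each of them becomes the integral of D(w - m) a(w) g(w, m). For fixed w
the velocity a(w) is a constant, and h(w) a(w) is the integral of
D(w - m) g(w, m) in m, so the inner integral is h(w) a(w)^2: the bound on V' is
in fact an equality. No regularity of a itself is needed, since h a^2 is a
partial integral of the continuous flux. *)
Require Import Defs.
From mathcomp Require Import all_boot all_order all_algebra.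
From mathcomp Require Import all_classical all_reals all_analysis.
From mathcomp Require Import measurable_realfun ring lra.
Import Order.TTheory GRing.Theory Num.Theory.
Import numFieldNormedType.Exports.
Set Implicit Arguments.
Unset Strict Implicit.
Unset Printing Implicit Defensive.
Local Open Scope classical_set_scope.
Local Open Scope ring_scope.

(** * Continuity of pairs, slices and swaps *)

Lemma continuous_compose {T U V : topologicalType} (f : T -> U) (g : U -> V) :
  continuous f -> continuous g -> continuous (fun x => g (f x)).
Proof. by move=> cf cg x; apply: (@continuous_comp _ _ _ f g);
  [exact: cf|exact: cg]. Qed.

Lemma continuous_pair {T U V : topologicalType} (f : T -> U) (g : T -> V) :
  continuous f -> continuous g -> continuous (fun x => (f x, g x)).
Proof. by move=> cf cg x; apply: cvg_pair; [exact: cf|exact: cg]. Qed.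

Lemma continuous_fst {T U V : topologicalType} (f : T -> U * V) :
  continuous f -> continuous (fun x => (f x).1).
Proof. by move=> cf x; apply: cvg_comp (cf x) _; exact: cvg_fst. Qed.

Lemma continuous_snd {T U V : topologicalType} (f : T -> U * V) :
  continuous f -> continuous (fun x => (f x).2).
Proof. by move=> cf x; apply: cvg_comp (cf x) _; exact: cvg_snd. Qed.

Lemma continuous_slice {T U V : topologicalType} (f : T * U -> V) (x : T) :
  continuous f -> continuous (fun y => f (x, y)).
Proof.
move=> cf y; apply: (continuous_comp (f := fun y => (x, y))) (cf _).
by apply: cvg_pair => //=; exact: cvg_cst.
Qed.

Lemma continuous_slicel {T U V : topologicalType} (f : T * U -> V) (y : U) :
  continuous f -> continuous (fun x => f (x, y)).
Proof.
move=> cf x; apply: (continuous_comp (f := fun x => (x, y))) (cf _).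
by apply: cvg_pair => //=; exact: cvg_cst.
Qed.

Lemma continuous_swap {T U V : topologicalType} (f : T * U -> V) :
  continuous f -> continuous (fun p : U * T => f (p.2, p.1)).
Proof.
move=> cf; apply: continuous_compose cf.
by apply: continuous_pair; [apply: continuous_snd|apply: continuous_fst] => p;
  exact: cvg_id.
Qed.

(** * Measurability, Fubini and parameter integrals for continuous integrands *)

Section ContinuousOnRectangle.
Context {R : realType}.
Local Notation mu := (@lebesgue_measure R).

Lemma nbhs_rat_itv (x : R) (A : set R) : nbhs x A ->
  exists p : rat * rat, `]ratr p.1, ratr p.2[%classic x /\
    `]ratr p.1, ratr p.2[ `<=` A.
Proof.
move=> /nbhs_ballP[e /= e0 xA].
have [p] := @rat_in_itvoo R (x - e) x ltac:(by rewrite ltrBlDr ltrDl).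
have [q] := @rat_in_itvoo R x (x + e) ltac:(by rewrite ltrDl).
rewrite !in_itv/= => /andP[xq qe] /andP[ep px].
exists (p, q); split => /=; first by rewrite in_itv/= px xq.
move=> y /=; rewrite in_itv/= => /andP[py yq]; apply: xA.
by rewrite /ball/= ltr_distlC; apply/andP; split; lra.
Qed.

(** An open set of the plane is the union of the boxes with rational corners that it contains. There
    are countably many of them, and each is measurable for the product sigma-algebra. *)
Lemma open_measurable_prod (A : set (R * R)) : open A -> measurable A.
Proof.
move=> oA.
pose box (p q : rat * rat) : set (R * R) :=
  `]ratr p.1, ratr p.2[%classic `*` `]ratr q.1, ratr q.2[%classic.
(* A box that is not contained in [A] is replaced by the empty set, so that the union may run over
   all quadruples of rationals. *)
pose B p q := if `[< box p q `<=` A >] then box p q else set0.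
have -> : A = \bigcup_p1 \bigcup_p2 \bigcup_q1 \bigcup_q2 B (p1, p2) (q1, q2).
  apply/seteqP; split => [[x y] Axy|z [p1 _ [p2 _ [q1 _ [q2 _]]]]]; last first.
    by rewrite /B; case: ifPn => // /asboolP; exact.
  have [[P Q] /= [/nbhs_rat_itv[[p1 p2] [xp pP]]] /nbhs_rat_itv[[q1 q2] [yq qQ]] PQA]
    : nbhs (x, y) A by exact: open_nbhs_nbhs.
  exists p1 => //; exists p2 => //; exists q1 => //; exists q2 => //.
  rewrite /B ifT//; apply/asboolP => -[u v] [/= up vq].
  by apply: PQA; split; [exact: pP|exact: qQ].
do 4 apply: bigcupT_measurable_rat => ?.
by rewrite /B; case: ifPn => _ //; apply: measurableX.
Qed.

Lemma continuous_measurable_prod (f : R * R -> R) :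
  continuous f -> measurable_fun setT f.
Proof.
move=> /continuousP cf; apply: (measurability _ (RGenOpens.measurableE R)).
move=> _ [_ [a [b ->] <-]]; rewrite setTI.
by apply: open_measurable_prod; apply: cf; exact: interval_open.
Qed.

Lemma continuous_integrable_itv (a b : R) (f : R -> R) : continuous f ->
  mu.-integrable `]a, b[ (EFin \o f).
Proof.
move=> cf; apply: (@integrableS _ _ _ mu `[a, b]%classic) => //.
  by apply: subset_itv; rewrite bnd_simp.
apply: continuous_compact_integrable; first exact: segment_compact.
exact: continuous_subspaceT.
Qed.

(** Fubini applies because [f] is bounded on the compact closed square and the open square has
    finite measure. *)
Lemma Rintegral_exchange (a b : R) (f : R * R -> R) : continuous f ->
  \int[mu]_(x in `]a, b[) \int[mu]_(y in `]a, b[) f (x, y) =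
  \int[mu]_(y in `]a, b[) \int[mu]_(x in `]a, b[) f (x, y).
Proof.
move=> cf.
have cfl y : continuous (fun x => f (x, y)) by exact: continuous_slicel.
pose I : set (measurableTypeR R) := `]a, b[%classic.
(* Fubini is used on the whole plane, so [f] is cut off to zero outside the open square. *)
pose F := (EFin \o f) \_ (I `*` I).
have mI : measurable (I `*` I) by apply: measurableX; exact: measurable_itv.
have iF : (mu \x mu)%E.-integrable setT F.
  apply: (iffLR (integrable_mkcond _ mI)).
  apply: measurable_bounded_integrable => //.
  - suff : (mu I * mu I < +oo)%E by rewrite -product_measure1E//; exact: measurable_itv.
    rewrite lebesgue_measure_itv/=.
    by case: ifPn => _; rewrite ?mule0// -!EFinD -EFinM ltry.
  - apply: measurable_funTS; exact: continuous_measurable_prod.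
  - have /compact_bounded : compact (f @` (`[a, b] `*` `[a, b])).
      apply: continuous_compact; first exact: continuous_subspaceT.
      by apply: compact_setX; exact: segment_compact.
    move=> [M [Mr fM]]; exists M; split => // N /fM fN [x y] [Ix Iy]; apply: fN;
      exists (x, y) => //=.
    by move: Ix Iy; rewrite !in_itv/= => /andP[/ltW-> /ltW->] /andP[/ltW-> /ltW->].
have E1 : (\int[mu]_x \int[mu]_y F (x, y))%E =
    (\int[mu]_(x in I) (\int[mu]_(y in I) f (x, y))%:E)%E.
  rewrite [RHS]integral_mkcond; apply: eq_integral => x _ /=.
  rewrite patchE; case: ifPn => xI.
    (* A real-valued integral is the [fine] part of an extended one; finiteness of the inner
       integral lets the two be identified. *)
    rewrite fineK; last by apply: integrable_fin_num;
      [exact: measurable_itv|apply: (@continuous_integrable_itv _ _ (fun y => f (x, y)))];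
      exact: continuous_slice.
    rewrite [RHS]integral_mkcond; apply: eq_integral => y _.
    by rewrite /F !patchE in_setX xI.
  by apply: integral0_eq => y _; rewrite /F patchE in_setX (negbTE xI).
have E2 : (\int[mu]_y \int[mu]_x F (x, y))%E =
    (\int[mu]_(y in I) (\int[mu]_(x in I) f (x, y))%:E)%E.
  rewrite [RHS]integral_mkcond; apply: eq_integral => y _ /=.
  rewrite patchE; case: ifPn => yI.
    rewrite fineK; last by apply: integrable_fin_num;
      [exact: measurable_itv|exact: (@continuous_integrable_itv _ _ (fun x => f (x, y)))].
    rewrite [RHS]integral_mkcond; apply: eq_integral => x _.
    by rewrite /F !patchE in_setX yI andbT.
  by apply: integral0_eq => x _; rewrite /F patchE in_setX (negbTE yI) andbF.
by congr fine; rewrite -[LHS]E1 -[RHS]E2; exact: Fubini.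
Qed.

Lemma Rintegral_dist_le (a b e : R) (f g : R -> R) : a <= b ->
  continuous f -> continuous g ->
  (forall x, `]a, b[%classic x -> `|f x - g x| <= e) ->
  `|\int[mu]_(x in `]a, b[) f x - \int[mu]_(x in `]a, b[) g x| <= e * (b - a).
Proof.
move=> ab cf cg fge.
have cfg : continuous (fun x => f x - g x) by move=> x; apply: cvgB;
  [exact: cf|exact: cg].
rewrite -RintegralB//; try exact: continuous_integrable_itv.
apply: le_trans (le_normr_Rintegral _ _) _ => //.
  exact: continuous_integrable_itv.
have -> : e * (b - a) = \int[mu]_(x in `]a, b[) (cst e x).
  have -> : b - a = fine (mu `]a, b[%classic).
    rewrite lebesgue_measure_itv/= lte_fin; case: ltP => //= ba.
    by apply/eqP; rewrite subr_eq0 eq_le ab ba.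
  by rewrite Rintegral_cst.
apply: le_Rintegral => //.
  apply: (@continuous_integrable_itv _ _ (fun x => `|f x - g x|)) => x.
  by apply: cvg_norm; exact: cfg.
by apply: continuous_integrable_itv => x; exact: cvg_cst.
Qed.

(** This is a tube argument: continuity at each [(x, y)] gives a product neighbourhood, and
    compactness of [K] yields one neighbourhood of [x] that serves every [y]. *)
Lemma near_uniform_dist {T U : topologicalType} (K : set U) (f : T * U -> R) (x : T)
  (e : R) :
  compact K -> continuous f -> 0 < e ->
  \forall x' \near x, forall y, K y -> `|f (x', y) - f (x, y)| <= e.
Proof.
move=> /compact_near_coveringP cK cf e0.
apply: (cK _ _ (fun x' y => `|f (x', y) - f (x, y)| <= e)) => y _.
(* Both [f (x', y')] and [f (x, y')] are compared with the value at the centre [(x, y)], and each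
   comparison costs half of [e]. *)
have e20 : 0 < e / 2 by rewrite divr_gt0.
have /cvgrPdist_le/(_ _ e20) := cf (x, y).
move=> [[A B] /= [xA yB] AB]; exists (B, A) => //= -[y' x'] [/= By' Ax'].
have h1 : `|f (x, y) - f (x', y')| <= e / 2 by exact: (AB (x', y')).
have h2 : `|f (x, y) - f (x, y')| <= e / 2 by apply: (AB (x, y')); split => //=;
  exact: nbhs_singleton.
rewrite (_ : _ - _ = (f (x, y) - f (x, y')) - (f (x, y) - f (x', y'))); last by ring.
by rewrite (le_trans (ler_normB _ _))// (splitr e) lerD.
Qed.

Lemma continuous_Rintegral {T : topologicalType} (a b : R) (f : T * R -> R) : a < b ->
  continuous f -> continuous (fun x => \int[mu]_(y in `]a, b[) f (x, y)).
Proof.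
move=> ab cf x; apply/cvgrPdist_le => e e0.
have e' : 0 < e / (b - a) by rewrite divr_gt0// subr_gt0.
have := @near_uniform_dist _ _ `[a, b] f x _ (@segment_compact _ _ _) cf e'.
apply: filterS => x' xx'; rewrite distrC.
apply: le_trans (Rintegral_dist_le (e := e / (b - a)) _ _ _ _) _; first exact: ltW.
- exact: continuous_slice.
- exact: continuous_slice.
- by move=> y yab; apply: xx'; exact: subset_itv_oo_cc.
- by rewrite divfK// gt_eqF// subr_gt0.
Qed.

End ContinuousOnRectangle.

(** * Derivatives relative to a set *)

Section RelativeDerivative.
Context {R : realType}.
Implicit Types (A : set R) (f F : R -> R).

Lemma derive_in_near_eq A f F (x : R) :
  (\forall y \near x, f y = F y) -> derive_in A f x = derive_in A F x.
Proof.
move=> fF; have fFx : f x = F x by exact: nbhs_singleton fF.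
have fF' : \forall y \near within A x^', f y = F y by do 2!apply: cvg_within.
rewrite /derive_in; congr lim; apply/seteqP; split => P /= HP.
  by apply: filterS2 fF' HP => y /= <-; rewrite fFx.
by apply: filterS2 fF' HP => y /= ->; rewrite fFx.
Qed.

(** Near an interior point of [A] the restriction to [A] does not change the punctured
    neighbourhoods, so the relative limit is an ordinary one. *)
Lemma cvg_within_is_derive A f (x l : R) : nbhs x A ->
  (fun y => (f y - f x) / (y - x)) @ within A x^' --> l -> is_derive x 1 f l.
Proof.
move=> nA df.
have ql : (fun y => (f y - f x) / (y - x)) @ x^' --> l.
  apply: cvg_trans df => P; rewrite /= => HP.
  have nA' : x^' A by exact: nbhs_dnbhs nA.
  have HP' : x^' (fun y => A y -> P ((f y - f x) / (y - x))) := HP.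
  suff : x^' (fun y => P ((f y - f x) / (y - x))) by [].
  by move: nA' HP'; apply: filterS2 => y Ay; exact.
(* The ordinary derivative is a limit in the increment [h], the relative one a limit in the endpoint
   [y]; they correspond through [y = h + x]. *)
have sl : (fun h => h^-1 *: ((f \o shift x) (h *: 1) - f x)) @ 0^' --> l.
  rewrite [X in X @ _](_ : _ = (fun y => (f y - f x) / (y - x)) \o (fun h => h + x));
    last first.
    by apply/funext => h /=; rewrite addrK [h *: 1]mulr1 mulrC.
  apply: cvg_comp ql => P [e /= e0 xeP]; exists e => //= h /= he h0.
  apply: xeP; last by rewrite -subr_eq0 addrK.
  by rewrite /ball_/= opprD addrCA subrr addr0 -[X in `|X|]sub0r.
by apply: DeriveDef; [apply: cvgP sl|exact: cvg_lim sl].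
Qed.

Lemma is_derive_derive_in A f (x : R) : nbhs x A ->
  derivable_in A f x -> is_derive x 1 f (derive_in A f x).
Proof. by move=> nA; exact: cvg_within_is_derive. Qed.

End RelativeDerivative.

(** * Fundamental theorem, mean values and differentiation under the integral *)

Section Calculus.
Context {R : realType}.
Local Notation mu := (@lebesgue_measure R).

Lemma Rintegral_derive (a b : R) (F f : R -> R) : a < b ->
  continuous F -> continuous f ->
  (forall x, `]a, b[%classic x -> is_derive x 1 F (f x)) ->
  \int[mu]_(x in `]a, b[) f x = F b - F a.
Proof.
move=> ab cF cf dF.
rewrite Rintegral_itv_obnd_cbnd; last exact: continuous_integrable_itv.
rewrite Rintegral_itv_bndo_bndc; last first.
  apply: (@integrableS _ _ _ mu `[a, b]%classic) => //.
    by apply: subset_itv; rewrite bnd_simp.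
  apply: continuous_compact_integrable; first exact: segment_compact.
  exact: continuous_subspaceT.
rewrite /Rintegral (@continuous_FTC2 _ f F)//.
- exact: continuous_subspaceT.
- split => [x xab||]; first by have /@ex_derive := dF x xab.
  + by apply: cvg_at_right_filter; exact: cF.
  + by apply: cvg_at_left_filter; exact: cF.
- by move=> x xab; rewrite derive1E; have /@derive_val := dF x xab.
Qed.

(** The form with minimum and maximum serves difference quotients whose endpoint may lie on either
    side of the base point. *)
Lemma MVT_between (f df : R -> R) (x y : R) : continuous f ->
  (forall z, Num.min x y < z < Num.max x y -> is_derive z 1 f (df z)) ->
  exists2 c, Num.min x y <= c <= Num.max x y & f x - f y = df c * (x - y).
Proof.
move=> cf; wlog xy : x y / x <= y => [hw dfz|].
  have /orP[xy|yx] := le_total x y; first exact: hw.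
  have [z|c cxy e] := hw y x yx; first by rewrite (minC y) (maxC y); exact: dfz.
  by exists c; [rewrite (minC x) (maxC x)|rewrite -opprB e -mulrN opprB].
rewrite min_l// max_r// => dfz.
have dfz' z : z \in `]x, y[ -> is_derive z 1 f (df z) by rewrite in_itv; exact: dfz.
have [c] := MVT_segment xy dfz' (continuous_subspaceT cf).
by rewrite in_itv => cxy e; exists c => //; rewrite -opprB e -mulrN opprB.
Qed.

(** For each [x] the mean value theorem turns the difference quotient into [df (c, x)] with [c]
    between [s] and [t], and [df (c, x)] is close to [df (t, x)] uniformly in [x]. Derivatives are
    asked for only at interior points of [A], so [t] itself may be an endpoint. *)
Lemma cvg_Rintegral_derive (A : set R) (a b : R) (f df : R * R -> R) (t : R) :
  a < b -> is_interval A -> A t -> continuous f -> continuous df ->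
  (forall s x, A° s -> `]a, b[%classic x ->
     is_derive s 1 (fun s => f (s, x)) (df (s, x))) ->
  (fun s => (\int[mu]_(x in `]a, b[) f (s, x) - \int[mu]_(x in `]a, b[) f (t, x))
            / (s - t)) @ within A t^' -->
  \int[mu]_(x in `]a, b[) df (t, x).
Proof.
move=> ab iA At cf cdf fdf; apply/cvgrPdist_le => e e0.
have e' : 0 < e / (b - a) by rewrite divr_gt0// subr_gt0.
have := @near_uniform_dist _ _ _ `[a, b] df t _ (@segment_compact _ _ _) cdf e'.
move=> /nbhs_ballP[d /= d0 td]; exists d => //= s /= ts sNt As.
have st : s - t != 0 by rewrite subr_eq0.
rewrite -RintegralB//; try by apply: continuous_integrable_itv; exact: continuous_slice.
have cfst : continuous (fun x => f (s, x) - f (t, x)).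
  by move=> x; apply: cvgB; exact: continuous_slice.
rewrite -RintegralZr//; last exact: continuous_integrable_itv.
rewrite -[leRHS](divfK (_ : b - a != 0)) ?gt_eqF ?subr_gt0//.
apply: Rintegral_dist_le; first exact: ltW.
- exact: continuous_slice.
- by move=> x; apply: cvgM; [exact: cfst|exact: cvg_cst].
move=> x xab.
have dst z : Num.min s t < z < Num.max s t ->
    is_derive z 1 (fun s => f (s, x)) (df (z, x)).
  set u := Num.min s t; set v := Num.max s t => zuv.
  (* Since [A] is an interval, the open interval between [s] and [t] lies in [A], hence in its
     interior, where the derivative is available. *)
  have uvA : `]u, v[ `<=` A.
    move=> y /=; rewrite in_itv/= => /andP[/ltW uy /ltW yv].
    have uA : A u by rewrite /u minEle; case: ifP.
    have vA : A v by rewrite /v maxEle; case: ifP.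
    by apply: iA uA vA _ _; apply/andP.
  apply: fdf => //; apply: filterS uvA _.
  by apply: open_nbhs_nbhs; split; [exact: interval_open|rewrite /= in_itv].
have cfx : continuous (fun s => f (s, x)) by exact: continuous_slicel.
have [c cst ->] := MVT_between cfx dst.
rewrite mulfK// distrC; apply: td; last exact: subset_itv_oo_cc.
move: ts cst; rewrite /ball/= !ltr_distl ge_min le_max.
by move=> /andP[? ?] /andP[/orP[?|?] /orP[?|?]]; apply/andP; split; lra.
Qed.

End Calculus.

(** * Integration by parts and the velocity identity *)

Section Dissipation.
Context {R : realType}.
Local Notation mu := (@lebesgue_measure R).

Lemma continuous_fun_mul {T : topologicalType} (f g : T -> R) :
  continuous f -> continuous g -> continuous (fun x => f x * g x).
Proof. by move=> cf cg x; apply: cvgM; [exact: cf|exact: cg]. Qed.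

Lemma continuous_fun_sub {T : topologicalType} (f g : T -> R) :
  continuous f -> continuous g -> continuous (fun x => f x - g x).
Proof. by move=> cf cg x; apply: cvgB; [exact: cf|exact: cg]. Qed.

Lemma continuous_diff_comp (W : R -> R) : continuous W ->
  continuous (fun p : R * R => W (p.1 - p.2)).
Proof.
move=> cW; apply: continuous_compose cW.
by apply: continuous_fun_sub; [apply: continuous_fst|apply: continuous_snd] => p;
  exact: cvg_id.
Qed.

(** Here [F] stands for the flux in [w] at a fixed time and [Fw] for its derivative. By symmetry the
    divergence of the other flux is [Fw (m, w)], so the bracket is the time derivative of the
    density. *)
Lemma energy_dissipation (a b : R) (W D : R -> R) (F Fw : R * R -> R) :
  a < b ->
  (forall x, W (- x) = W x) -> continuous D ->
  (forall x : R, is_derive x 1 W (- D x)) ->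
  continuous F -> continuous Fw ->
  (forall w m : R, `]a, b[%classic w -> `]a, b[%classic m ->
     is_derive w 1 (fun w => F (w, m)) (Fw (w, m))) ->
  (forall m, `]a, b[%classic m -> F (a, m) = 0 /\ F (b, m) = 0) ->
  \int[mu]_(m in `]a, b[) \int[mu]_(w in `]a, b[)
     (W (w - m) * (- Fw (w, m) - Fw (m, w))) =
  - 2 * \int[mu]_(w in `]a, b[) \int[mu]_(m in `]a, b[) (D (w - m) * F (w, m)).
Proof.
move=> ab We cD dW cF cFw dF F0.
have cW : continuous W.
  by move=> x; apply: differentiable_continuous; apply/derivable1_diffP;
    have /@ex_derive := dW x.
pose A (p : R * R) := W (p.1 - p.2) * Fw p.
have cA : continuous A by apply: continuous_fun_mul cFw; exact: continuous_diff_comp.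
pose A' (p : R * R) := W (p.1 - p.2) * Fw (p.2, p.1).
have cA' : continuous A'.
  by apply: continuous_fun_mul; [exact: continuous_diff_comp|exact: continuous_swap].
pose B (p : R * R) := D (p.1 - p.2) * F p.
have cB : continuous B by apply: continuous_fun_mul cF; exact: continuous_diff_comp.
pose dint (f : R * R -> R) := \int[mu]_(m in `]a, b[) \int[mu]_(w in `]a, b[) f (w, m).
have inner (f : R * R -> R) : continuous f ->
  continuous (fun m : R => \int[mu]_(w in `]a, b[) f (w, m)).
  by move=> cf; apply: (@continuous_Rintegral R R a b (fun p => f (p.2, p.1)) ab);
    exact: continuous_swap.
have dintB (f g : R * R -> R) : continuous f -> continuous g ->
    dint f - dint g = dint (fun p => f p - g p).
  move=> cf cg; rewrite /dint -RintegralB//; try by apply: continuous_integrable_itv;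
    exact: inner.
  by apply: eq_Rintegral => m _; rewrite RintegralB//;
    apply: continuous_integrable_itv; exact: continuous_slicel.
(* As [W' = - D], the difference [A - B] is the [w]-derivative of [W (w - m) * F (w, m)], which
   vanishes at both ends because [F] does. *)
have AB : dint A = dint B.
  apply: eq_Rintegral => m; rewrite inE => mI.
  apply/eqP; rewrite -subr_eq0 -RintegralB//; try by apply: continuous_integrable_itv;
    exact: continuous_slicel.
  pose u (w : R) := W (w - m) * F (w, m).
  have cu : continuous u.
    apply: (@continuous_slicel _ _ _ (fun p => W (p.1 - p.2) * F p)).
    by apply: continuous_fun_mul cF; exact: continuous_diff_comp.
  have cAB : continuous (fun w => A (w, m) - B (w, m)).
    by apply: (@continuous_slicel _ _ _ (fun p => A p - B p));
      exact: continuous_fun_sub.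
  have du (w : R) : `]a, b[%classic w -> is_derive w 1 u (A (w, m) - B (w, m)).
    move=> wI; have dFw := dF w m wI mI.
    have dWw : is_derive w 1 (fun w => W (w - m)) (- D (w - m)).
      have dB : is_derive w 1 (fun w => w - m) 1 by exact: (is_derive_shift w 1 (- m)).
      by have := @is_derive1_comp _ W (fun w => w - m) w _ _ (dW (w - m)) dB;
        rewrite mulr1.
    apply: (is_derive_eq (is_deriveM dWw dFw)).
    by rewrite /A /B /= /GRing.scale/=; ring.
  rewrite (Rintegral_derive ab cu cAB du).
  by rewrite /u !(F0 m mI).1 !(F0 m mI).2 !mulr0 subrr.
(* Exchanging the order of integration swaps the names of [w] and [m]; evenness of [W] then turns
   [A'] into [A]. *)
have A'A : dint A' = dint A.
  have /(Rintegral_exchange a b) := continuous_swap cA'; rewrite /dint /= => ->.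
  by apply: eq_Rintegral => m _; apply: eq_Rintegral => w _;
    rewrite /A' /A /= -We opprB.
have -> : \int[mu]_(w in `]a, b[) \int[mu]_(m in `]a, b[) (D (w - m) * F (w, m)) =
  dint B.
  exact: (Rintegral_exchange a b cB).
(* Writing the negated sum as [(0 - A) - A'] lets linearity be used through differences alone. *)
transitivity (dint (fun p => (0 - A p) - A' p)).
  by apply: eq_Rintegral => m _; apply: eq_Rintegral => w _; rewrite /A /A' /=; ring.
have c0 : continuous (fun _ : R * R => 0 : R) by move=> ?; exact: cvg_cst.
rewrite -dintB//; last exact: continuous_fun_sub.
rewrite -dintB// A'A AB.
have -> : dint (fun=> 0) = 0.
  rewrite /dint; under eq_Rintegral do rewrite Rintegral_cst// mul0r.
  by rewrite Rintegral_cst// mul0r.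
by ring.
Qed.

(* Where eta takes its default value 0, or h vanishes and the division by 0 gives
0, the velocity is 0 and so are both sides. *)
Lemma Rintegral_eta_velocity (D : R -> R) (g : R -> R -> R) (k : R -> R) (w : R) :
  continuous D -> continuous k -> (forall m, Omega m -> g w m = k m) ->
  \int[mu]_(m in Omega) (D (w - m) * (velocity D g w * g w m)) =
  (\int[mu]_(m in Omega) g w m) * velocity D g w ^+ 2.
Proof.
move=> cD ck gk; set a := velocity D g w; set H := \int[mu]_(m in Omega) g w m.
have mO : measurable (Omega : set R) by exact: measurable_itv.
(* Integrability is drawn from continuity on the whole line, so [k] stands in for [g w], with which
   it agrees on [Omega]. *)
have cDk : continuous (fun m => D (w - m) * k m).
  apply: continuous_fun_mul ck; apply: continuous_compose cD.
  by apply: continuous_fun_sub => x; [exact: cvg_cst|exact: cvg_id].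
have -> : \int[mu]_(m in Omega) (D (w - m) * (a * g w m)) =
    a * \int[mu]_(m in Omega) (D (w - m) * k m).
  rewrite -RintegralZl//; last exact: continuous_integrable_itv.
  by apply: eq_Rintegral => m /set_mem Om; rewrite (gk m Om); ring.
have [->|a0] := eqVneq a 0; first by rewrite mul0r expr0n mulr0.
suff -> : \int[mu]_(m in Omega) (D (w - m) * k m) = H * a by ring.
have vel0 : (forall m, eta g w m = 0) -> a = 0.
  move=> e0; rewrite /a /velocity; under eq_Rintegral do rewrite e0 mul0r.
  by rewrite Rintegral_cst// mul0r.
have etaE m : eta g w m = g w m / H.
  (* The test inside [eta] depends on [w] alone, so taking the default at one [m] means taking it at
     every [m], which would force [a = 0]. *)
  rewrite /eta; case: ifPn => // g0; exfalso; move/eqP: a0; apply; apply: vel0 => m'.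
  by rewrite /eta g0.
have H0 : H != 0.
  apply/eqP => H0; move/eqP: a0; apply; apply: vel0 => m.
  by rewrite etaE H0 invr0 mulr0.
have -> : a = H^-1 * \int[mu]_(m in Omega) (D (w - m) * k m).
  rewrite -RintegralZl//; last exact: continuous_integrable_itv.
  by apply: eq_Rintegral => m /set_mem Om; rewrite etaE (gk m Om); ring.
by rewrite mulrA divff// mul1r.
Qed.

End Dissipation.

(** * Continuous extension from the closed cylinder *)

Section Clamping.
Context {R : realType}.

Definition clamp (x : R) : R := Num.max (-1) (Num.min 1 x).

Lemma clOmega_clamp (x : R) : clOmega (clamp x).
Proof.
rewrite /clOmega/= in_itv/= /clamp le_max ge_max ge_min !lexx/= andbT.
by rewrite -subr_ge0 opprK addr_ge0.
Qed.

Lemma clamp_id (x : R) : clOmega x -> clamp x = x.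
Proof. by rewrite /clOmega/= in_itv/= => /andP[x1 x2];
  rewrite /clamp min_r// max_r. Qed.

Lemma Omega_clOmega : Omega `<=` (clOmega : set R).
Proof. exact: subset_itv_oo_cc. Qed.

Lemma continuous_clamp : continuous clamp.
Proof.
move=> x; apply: (continuous_max (f := fun=> -1)); first exact: cvg_cst.
by apply: (continuous_min (f := fun=> 1)); [exact: cvg_cst|exact: cvg_id].
Qed.

Lemma nbhs_Omega (x : R) : Omega x -> nbhs x (Omega : set R).
Proof. by move=> Ox; apply: open_nbhs_nbhs; split => //; exact: interval_open. Qed.

Lemma nbhs_clOmega (x : R) : Omega x -> nbhs x (clOmega : set R).
Proof. by move=> /nbhs_Omega; apply: filterS; exact: Omega_clOmega. Qed.

(* Composition with the retraction onto the closed cylinder turns continuity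
within the cylinder into continuity on the whole space. *)
Definition extend (f : R -> R -> R -> R) (p : R * R * R) : R :=
  f (Num.max 0 p.1.1) (clamp p.1.2) (clamp p.2).

Lemma extendE (f : R -> R -> R -> R) (t w m : R) :
  times t -> clOmega w -> clOmega m -> extend f (t, w, m) = f t w m.
Proof.
by rewrite /times/= in_itv/= andbT => t0 cw cm; rewrite /extend/= max_r// !clamp_id.
Qed.

Lemma continuous_extend (f : R -> R -> R -> R) :
  cylinder_continuous f -> continuous (extend f).
Proof.
move=> /subspace_continuousP cf.
pose r (p : R * R * R) := (Num.max 0 p.1.1, clamp p.1.2, clamp p.2).
have cid : continuous (fun p : R * R * R => p) by move=> p; exact: cvg_id.
have cr : continuous r.
  apply: continuous_pair; first apply: continuous_pair.
  - move=> p; apply: (@continuous_max _ _ (fun=> 0) (fun p => p.1.1));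
    first exact: cvg_cst.
    exact: (continuous_fst (continuous_fst cid)).
  - apply: (@continuous_compose _ _ _ (fun p : R * R * R => p.1.2) clamp).
      exact: (continuous_snd (continuous_fst cid)).
    exact: continuous_clamp.
  - apply: (@continuous_compose _ _ _ (fun p : R * R * R => p.2) clamp).
      exact: (continuous_snd cid).
    exact: continuous_clamp.
have rcyl p : cylinder (r p).
  split; [split|]; [|exact: clOmega_clamp|exact: clOmega_clamp].
  by rewrite /times/= in_itv/= le_max lexx.
move=> p; apply: (@cvg_comp _ _ _ r (fun p => f p.1.1 p.1.2 p.2) _ _ _ _ (cf _ (rcyl
  p))).
(* A neighbourhood relative to the cylinder constrains only points of the cylinder, and every value
   of [r] is one. *)
move=> A /= nA.
have nB : nbhs p (fun q => cylinder (r q) -> A (r q)) := cr p _ nA.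
by apply: (filterS _ nB : nbhs p (r @^-1` A)) => q; apply; exact: rcyl.
Qed.

End Clamping.

(** * Time derivative of the double integral *)

Section TimeDerivative.
Context {R : realType}.
Local Notation mu := (@lebesgue_measure R).

Lemma times_interior (t : R) : (times° t) -> nbhs t (times : set R) /\ times t.
Proof. by move=> tt; split => //; exact: interior_subset. Qed.

(** Differentiation under the integral is used twice. At interior times the inner integral gets an
    ordinary derivative, which is what the outer use requires; the outer one is then allowed at
    [t = 0]. *)
Lemma cvg_Rintegral2_derive (W : R -> R) (f ft : R * R * R -> R) (t : R) :
  continuous W -> continuous f -> continuous ft -> times t ->
  (forall s w m : R, times° s -> Omega w -> Omega m ->
     is_derive s 1 (fun s => f (s, w, m)) (ft (s, w, m))) ->
  let V s := \int[mu]_(m in Omega) \int[mu]_(w in Omega) (W (w - m) * f (s, w, m)) in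
  (fun s => (V s - V t) / (s - t)) @ within times t^' -->
  \int[mu]_(m in Omega) \int[mu]_(w in Omega) (W (w - m) * ft (t, w, m)).
Proof.
move=> cW cf cft tt dfs V.
have N11 : -1 < 1 :> R by lra.
have itimes : is_interval (times : set R) by exact: interval_is_interval.
(* The variables are regrouped as [((s, m), w)]: the inner integration variable comes last and the
   pair [(s, m)] is the parameter. *)
pose u (k : R * R * R -> R) (q : R * R * R) := W (q.2 - q.1.2) * k (q.1.1, q.2, q.1.2).
have cid : continuous (fun q : R * R * R => q) by move=> q; exact: cvg_id.
have cu k : continuous k -> continuous (u k).
  move=> ck; apply: continuous_fun_mul.
    apply: continuous_compose cW; apply: continuous_fun_sub;
      first exact: continuous_snd.
    exact: (continuous_snd (continuous_fst cid)).
  apply: continuous_compose ck; apply: continuous_pair;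
    last exact: (continuous_snd (continuous_fst cid)).
  by apply: continuous_pair; [exact: (continuous_fst (continuous_fst cid))|exact:
    continuous_snd].
pose U k (p : R * R) := \int[mu]_(w in Omega) u k (p, w).
have cU k : continuous k -> continuous (U k).
  by move=> ck; apply: continuous_Rintegral => //; exact: cu.
apply: (cvg_Rintegral_derive (f := U f) (df :=
  U ft) N11 itimes tt (cU _ cf) (cU _ cft)).
move=> s m si Om; have [ns ts] := times_interior si.
(* With [m] frozen, the remaining variables are [(s, w)]. *)
pose I (k : R * R * R -> R) (p : R * R) := u k (p.1, m, p.2).
have cI k : continuous k -> continuous (I k).
  move=> ck; apply: continuous_compose (cu k ck).
  have cid2 : continuous (fun q : R * R => q) by move=> q; exact: cvg_id.
  apply: continuous_pair; last exact: continuous_snd.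
  by apply: continuous_pair; [exact: continuous_fst|move=> q; exact: cvg_cst].
have dI (s' w : R) : times° s' -> Omega w ->
    is_derive s' 1 (fun s => I f (s, w)) (I ft (s', w)).
  by move=> si' Ow; exact: (is_deriveZ (W (w - m)) (dfs s' w m si' Ow Om)).
apply: cvg_within_is_derive ns _.
exact: cvg_Rintegral_derive (cI _ cf) (cI _ cft) dI.
Qed.

(** Points slightly to the right of [t] always remain in [times]. Properness makes limits along this
    filter unique, so that [derive_in] can be computed. *)
Lemma within_times_proper (t : R) : times t -> ProperFilter (within times t^').
Proof.
rewrite /times/= in_itv/= andbT => t0; apply: Build_ProperFilter_ex => P [e /= e0 teP].
exists (t + e / 2); apply: teP => /=.
- by rewrite opprD addrA subrr sub0r normrN gtr0_norm; lra.
- by rewrite gt_eqF//; lra.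
- by rewrite in_itv/= andbT; lra.
Qed.

End TimeDerivative.

(** * Dissipation of the interaction energy *)

Theorem lemma3p11 (R : realType) (W D : R -> R) (g : R -> R -> R -> R)
  (W_ge0 : forall x : R, 0 <= W x)
  (W_smooth : smooth W)
  (W_convex : strictly_convex W)
  (W_even : forall x : R, W (- x) = W x)
  (W_min : forall x : R, x != 0 -> W 0 < W x)
  (D_def : forall x : R, D x = - (W^`())%classic x)
  (g_ge0 : forall t w m : R, times t -> Omega w -> Omega m -> 0 <= g t w m)
  (g_sym : forall t w m : R, times t -> Omega w -> Omega m ->
     g t w m = g t m w)
  (g_regular : sufficiently_regular D g)
  (g_eq : forall t w m : R, times t -> Omega w -> Omega m ->
     d_t g t w m + d_w (flux_w D g) t w m + d_m (flux_m D g) t w m = 0)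
  (zero_flux_w : forall t w m : R, times t -> bdOmega w -> Omega m ->
     flux_w D g t w m = 0)
  (zero_flux_m : forall t w m : R, times t -> Omega w -> bdOmega m ->
     flux_m D g t w m = 0) :
  forall t : R, times t ->
    [/\ derivable_in times (Vtilde W g) t,
        derive_in times (Vtilde W g) t
          <= - 2 * \int[@lebesgue_measure R]_(w in Omega)
                     (h g t w * velocity D (g t) w ^+ 2) &
        - 2 * \int[@lebesgue_measure R]_(w in Omega)
                (h g t w * velocity D (g t) w ^+ 2) <= 0].
Proof.
move=> t tt.
have N11 : -1 < 1 :> R by lra.
have dW n x : derivable (W^`(n))%classic x 1 := W_smooth n x.
have dWD (x : R) : is_derive x 1 W (- D x).
  by rewrite D_def opprK derive1E; apply: derivableP; exact: (dW 0%N).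
have cD : continuous D.
  have -> : D = (fun x => - (W^`())%classic x) by apply/funext.
  by move=> x; apply: cvgN; apply: differentiable_continuous; apply/derivable1_diffP;
    exact: (dW 1%N).
have cW : continuous W.
  by move=> x; apply: differentiable_continuous; apply/derivable1_diffP;
    exact: (dW 0%N).
have [[cg [dgt cgt] _ _] cF [dF cFw]] := g_regular.
have clO : Omega `<=` (clOmega : set R) := @Omega_clOmega R.
pose G := extend g; pose Gt := extend (d_t g).
pose F (p : R * R) := extend (flux_w D g) (t, p.1, p.2).
pose Fw (p : R * R) := extend (d_w (flux_w D g)) (t, p.1, p.2).
have cslice f : cylinder_continuous f ->
  continuous (fun p : R * R => extend f (t, p.1, p.2)).
  move=> /continuous_extend cf; apply: continuous_compose cf.
  have cid : continuous (fun q : R * R => q) by move=> q; exact: cvg_id.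
  apply: continuous_pair; last exact: continuous_snd.
  by apply: continuous_pair; [move=> q; exact: cvg_cst|exact: continuous_fst].
have dG (s w m : R) : times° s -> Omega w -> Omega m ->
    is_derive s 1 (fun s => G (s, w, m)) (Gt (s, w, m)).
  move=> si /clO Ow /clO Om; have [ns ts] := times_interior si.
  have := is_derive_derive_in ns (dgt s w m ts Ow Om).
  rewrite /Gt extendE//; apply: near_eq_is_derive.
  by apply: filterS ns => s' ts'; rewrite /G extendE.
have dFw (w m : R) : Omega w -> Omega m ->
    is_derive w 1 (fun w => F (w, m)) (Fw (w, m)).
  move=> Ow Om; have := is_derive_derive_in (nbhs_clOmega Ow) (dF t w m tt (clO _ Ow)
    (clO _ Om)).
  rewrite /Fw extendE//; [|exact: clO|exact: clO]; apply: near_eq_is_derive.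
  by apply: filterS (nbhs_clOmega Ow) => w' cw'; rewrite /F extendE//; exact: clO.
have F0 (m : R) : Omega m -> F (-1, m) = 0 /\ F (1, m) = 0.
  have cl1 : clOmega (1 : R) by rewrite /clOmega/= in_itv/= lexx andbT; lra.
  have clN1 : clOmega (-1 : R) by rewrite /clOmega/= in_itv/= lexx; lra.
  move=> Om; have cm := clO _ Om.
  by rewrite /F !extendE//; split; apply: zero_flux_w => //; [left|right].
have GtE (w m : R) : Omega w -> Omega m -> Gt (t, w, m) = - Fw (w, m) - Fw (m, w).
  move=> Ow Om; rewrite /Gt /Fw !extendE//; try exact: clO.
  (* Symmetry of [g] is given on the open square only. That suffices, since the two functions of [n]
     agree near the interior point [m]. *)
  have -> : d_w (flux_w D g) t m w = d_m (flux_m D g) t w m.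
    apply: derive_in_near_eq; apply: filterS (nbhs_Omega Om) => n On.
    by rewrite /flux_w /flux_m g_sym.
  by have := g_eq t w m tt Ow Om => /=; lra.
set Q := \int[@lebesgue_measure R]_(w in Omega) (h g t w * velocity D (g t) w ^+ 2).
have VE s : times s -> Vtilde W g s =
    \int[@lebesgue_measure R]_(m in Omega) \int[@lebesgue_measure R]_(w in Omega)
      (W (w - m) * G (s, w, m)).
  move=> ts; apply: eq_Rintegral => m /set_mem Om; apply: eq_Rintegral => w /set_mem Ow.
  by rewrite /G extendE//; exact: clO.
(* For fixed [w] the inner integral is [h] times the squared velocity. *)
have QE : \int[@lebesgue_measure R]_(w in Omega) \int[@lebesgue_measure R]_(m in Omega)
    (D (w - m) * F (w, m)) = Q.
  apply: eq_Rintegral => w /set_mem Ow.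
  rewrite -(@Rintegral_eta_velocity _ D (g t) (fun m => G (t, w, m)))//.
  - apply: eq_Rintegral => m /set_mem Om; rewrite /F extendE//; exact: clO.
  - exact: (continuous_slice (cslice g cg)).
  - by move=> m Om; rewrite /G extendE//; exact: clO.
have cvV : (fun s => (Vtilde W g s - Vtilde W g t) / (s - t)) @ within times t^' -->
  - 2 * Q.
  rewrite -QE -(energy_dissipation N11 W_even cD dWD (cslice _ cF) (cslice _ cFw) dFw
    F0).
  rewrite [X in _ --> X](_ : _ = \int[@lebesgue_measure R]_(m in Omega)
     \int[@lebesgue_measure R]_(w in Omega) (W (w - m) * Gt (t, w, m))); last first.
    apply: eq_Rintegral => m /set_mem Om; apply: eq_Rintegral => w /set_mem Ow.
    by rewrite GtE.
  have := cvg_Rintegral2_derive cW (continuous_extend cg) (continuous_extend cgt) tt dG.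
  apply: cvg_trans; apply: near_eq_cvg.
  (* The identity [VE] holds for nonnegative times only, and the filter sees no others. *)
  have : \forall s \near within times t^', times s by exact: withinT.
  by apply: filterS => s ts; rewrite !VE.
have PF := within_times_proper tt.
split; first exact: cvgP cvV.
  by rewrite /derive_in (cvg_lim _ cvV).
(* The sign comes from [g_ge0], which makes [h] nonnegative. *)
rewrite mulNr oppr_le0 mulr_ge0// Rintegral_ge0// => w Ow.
by rewrite mulr_ge0 ?sqr_ge0// Rintegral_ge0// => m Om; exact: g_ge0.
Qed.
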